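(* Let $\mathcal Q,\mathcal Y,Y,\mathfrak c,F,F_n$ be as in the context, and assume the following. (Weak Quadruple) There are a measurable $\mathfrak a:\mathcal Y\times\mathcal Y\to[0,\infty)$ and a pseudo-metric $\mathfrak b:\mathcal Q\times\mathcal Q\to[0,\infty)$ such that for all $p,q\in\mathcal Q$, $y,z\in\mathcal Y$, $$\mathfrak c(y,q)-\mathfrak c(z,q)-\mathfrak c(y,p)+\mathfrak c(z,p)\le\mathfrak a(y,z)\,\mathfrak b(q,p).$$ (Existence') $\mathbb E[|\mathfrak c(Y,q)|]<\infty$ for all $q\in\mathcal Q$. Let $o\in\mathcal Q$, $R_n:=n$ and $\mathcal Q_n:=\mathrm B_{R_n}(o,\mathfrak b)$. There are measurable $m_n^{\mathcal Q_n}\in\arg\min_{q\in\mathcal Q_n}F_n(q)$ and an $m\in\arg\min_{q\in\mathcal Q}F(q)$. (Growth) There are constants $\gamma>1$, $c_{\mathsf g}>0$ such that $F(q)-F(m)\ge c_{\mathsf g}\,\mathfrak b(m,q)^\gamma$ for all $q\in\mathcal Q$. (Strong Moment) $\kappa>\gamma-1$ and $\mathfrak M\big(\frac{\kappa}{\gamma-1}\big)<\infty$. (Small Entropy) There are $\beta,c_{\mathsf e}>0$ such that for all $\delta>0$ large enough $$\sqrt{\log N(\mathrm B_\delta(o,\mathfrak b),\mathfrak b,r)}\le c_{\mathsf e}\Big(\log\frac\delta r\Big)^\beta\quad\text{for all }r\in(0,\delta].$$ Then, as $n\to\infty$, $$\mathbb E\big[\mathfrak b(m,m_n^{\mathcal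 Q_n})^\kappa\big]=O\Big(\big(n^{-\frac12}\log(n)^\beta\big)^{\frac{\kappa}{\gamma-1}}\Big).$$
   Context: Setting: $\mathcal Q$ is a set (descriptor space), $(\mathcal Y,\Sigma_{\mathcal Y})$ a measurable space (data space), $Y$ a $\mathcal Y$-valued random variable, $\mathfrak c:\mathcal Y\times\mathcal Q\to\mathbb R$ (cost function) is such that $y\mapsto\mathfrak c(y,q)$ is measurable for every $q\in\mathcal Q$. $F(q):=\mathbb E[\mathfrak c(Y,q)]$. For $n\in\mathbb N$, $Y_1,\dots,Y_n$ are independent copies of $Y$ and $F_n(q):=\frac1n\sum_{i=1}^n\mathfrak c(Y_i,q)$. With $Y'$ an independent copy of $Y$ and $\zeta>0$, $\mathfrak M(\zeta):=\mathbb E[\mathfrak a(Y',Y)^\zeta]$ if $\zeta\ge2$ and $\mathfrak M(\zeta):=\mathbb E[\mathfrak a(Y',Y)^2]^{\zeta/2}$ if $\zeta\le2$. $\mathrm B_r(o,\mathfrak b):=\{q\in\mathcal Q:\mathfrak b(o,q)\le r\}$. For $A\subseteq\mathcal Q$, $N(A,\mathfrak b,r)$ is the minimal $k\in\mathbb N$ such that there are $q_1,\dots,q_k\in\mathcal Q$ with $A\subseteq\bigcup_{j=1}^k\mathrm B_r(q_j,\mathfrak b)$. *)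

(* Defs.v *)
From HB Require Import structures.
From mathcomp Require Import all_boot all_order all_algebra.
From mathcomp Require Import all_classical all_reals all_analysis.

Set Implicit Arguments.
Unset Strict Implicit.
Unset Printing Implicit Defensive.

Import Order.TTheory GRing.Theory Num.Theory.
Import numFieldNormedType.Exports.

Local Open Scope classical_set_scope.
Local Open Scope ring_scope.

Definition argmin (R : realType) (Q : Type) (A : set Q) (f : Q -> R) : set Q :=
  [set q | A q /\ forall p, A p -> f q <= f p].

Section PseudoMetric.
Variables (R : realType) (Q : Type).
Implicit Types (b : Q -> Q -> R) (A : set Q).

Definition pseudo_metric b : Prop :=
  [/\ forall p q, 0 <= b p q,
      forall q, b q q = 0,
      forall p q, b p q = b q p
    & forall p q r, b p r <= b p q + b q r].

Definition cball (o : Q) b (r : R) : set Q := [set q | b o q <= r].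

Definition pm_open b : set (set Q) :=
  [set U | forall q, U q -> exists2 e : R, 0 < e & cball q b e `<=` U].

(* A set of descriptors carries no sigma-algebra of its own: measurability of
   a Q-valued map refers to the Borel sigma-algebra of the pseudo-metric. *)
Definition pm_borel b : set (set Q) := <<s pm_open b >>.

Definition pm_measurable_fun (d : measure_display) (T : measurableType d)
    b (f : T -> Q) : Prop :=
  forall U, pm_borel b U -> measurable (f @^-1` U).

Definition covered_by A b (r : R) (k : nat) : Prop :=
  exists q : 'I_k -> Q, A `<=` \bigcup_j cball (q j) b r.

(* The least k such that A is covered by k balls; it is +oo if no finite
   cover exists. *)
Definition covering_number A b (r : R) : \bar R :=
  ereal_inf [set (k%:R)%:E | k in [set k | covered_by A b r k]].

End PseudoMetric.

Section Probability.
Variables (d dY : measure_display) (Omega : measurableType d)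
  (YY : measurableType dY) (R : realType) (P : probability Omega R).

Definition same_law (X Y : {RV P >-> YY}) : Prop :=
  forall A, measurable A -> distribution P X A = distribution P Y A.

Definition independent_pair (X Y : {RV P >-> YY}) : Prop :=
  forall A B, measurable A -> measurable B ->
    P ((X @^-1` A) `&` (Y @^-1` B)) = (P (X @^-1` A) * P (Y @^-1` B))%E.

Definition independent_seq (X : nat -> {RV P >-> YY}) : Prop :=
  forall (s : seq nat) (A : nat -> set YY), uniq s ->
    (forall i, measurable (A i)) ->
    P (\big[setI/setT]_(i <- s) (X i @^-1` A i)) =
    (\prod_(i <- s) P (X i @^-1` A i))%E.

Variables (Q : Type) (c : YY -> Q -> R).

Definition objective (Y : {RV P >-> YY}) (q : Q) : R :=
  fine 'E_P[(fun w => c (Y w) q)]%E.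

(* The n observations are Ys 0, ..., Ys (n - 1). *)
Definition empirical_objective (Ys : nat -> {RV P >-> YY}) (n : nat)
    (w : Omega) (q : Q) : R :=
  n%:R^-1 * \sum_(i < n) c (Ys i w) q.

(* Y' is meant to be an independent copy of Y. *)
Definition moment (a : YY -> YY -> R) (Y' Y : {RV P >-> YY}) (zeta : R)
    : \bar R :=
  if 2 <= zeta then 'E_P[(fun w => (a (Y' w) (Y w) `^ zeta)%R)]%E
  else ('E_P[(fun w => (a (Y' w) (Y w) ^+ 2)%R)] `^ (zeta / 2))%E.

End Probability.

(* Main.v *)
Require Import Defs.
From HB Require Import structures.
From mathcomp Require Import all_boot all_order all_algebra.
From mathcomp Require Import all_classical all_reals all_analysis.
From mathcomp Require Import measurable_realfun ring lra.

Set Implicit Arguments.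
Unset Strict Implicit.
Unset Printing Implicit Defensive.

Import Order.TTheory GRing.Theory Num.Theory.
Import numFieldNormedType.Exports.

Local Open Scope classical_set_scope.
Local Open Scope ring_scope.

(** Let F q be the expectation of c (Y, q), let g (y, q) = c (y, q) - F q be the
centred cost, zeta = kappa / (gamma - 1) and p = max (2, zeta).  The growth
condition and the minimality of m_n give
  c_g b(m, m_n)^gamma <= F m_n - F m <= mean over i of g (Y_i, m) - g (Y_i, m_n),
so everything rests on a bound of these means relative to the distance to m.

Envelope.  For a fixed observation z0 the quadruple inequality makes g (y, .)
Lipschitz with constant A y + E A, where A y = a (y, z0) (centred_lipschitz), and
Fubini provides a z0 for which A has a p-th moment (exists_reference_point).

One net suffices.  As the entropy grows like a power of a logarithm, a net of
polynomially small radius r = n^(- 1 / (2 (gamma - 1))) n^(- 1/2) of the ball of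
radius n has a log-cardinality of order (ln n)^(2 beta), which is the size that
the rate allows; no chaining over scales is needed.  If b(m, m_n) is at most
n^(- 1 / (2 (gamma - 1))), the rate holds trivially.  Otherwise r is at most
n^(- 1/2) b(m, m_n), the Lipschitz error of the net is negligible, and
b(m, m_n)^(gamma - 1) is controlled by the means of the normalized deviations
(g (., q_j) - g (., m)) / b(m, q_j) at the points of the net (argmin_rate).
Normalizing, rather than summing over shells around m, saves a factor ln n.

Maximal inequality.  The normalized deviations are centred and share the envelope
A + E A, of which only p moments are available, while the net may be of
superpolynomial size.  Their running sums, rescaled by sqrt (l / n) with l of the
order of the log-cardinality, are followed through the potential
lse u = 1 + ln (sum over j of exp u_j + exp (- u_j)), which dominates every |u_j|.
In the second-order expansion of lse^p the linear term has mean zero and the rest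
is at most C / n times lse^p (lse_powR_step), so an independent step multiplies
E lse^p by at most 1 + C / n, and n steps by at most exp C (integral_lse_walk).
Hence the largest mean is of order sqrt (l / n) in L^p.

Finally b(m, m_n)^(gamma - 1) <= C sqrt (l / n) (lse / l) with lse / l >= 1, so that
the power zeta of the last factor is dominated by its power p (moment_rate), and
sqrt (l / n) = O(n^(- 1/2) (ln n)^beta) (lse_scale_le). *)

(** * Real inequalities *)

Section real_inequalities.
Context {R : realType}.
Implicit Types p s t x y : R.

Lemma expR_le_quadratic x : x <= 2^-1 -> expR x <= 1 + x + 2 * x ^+ 2.
Proof.
move=> x2.
have x1 : 0 < 1 - x by lra.
have : 1 - x <= (expR x)^-1 by rewrite -expRN; have := expR_ge1Dx (- x).
rewrite -lef_pV2 ?posrE ?invr_gt0 ?expR_gt0// invrK => /le_trans; apply.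
rewrite -[leLHS]mul1r ler_pdivrMr//; nra.
Qed.

(** With y = t / s: if p * y <= 1/2, then (1 + y)^p <= exp (p * y), to which
expR_le_quadratic applies; otherwise 1 + y <= (2 * p + 1) * y, and the last
term alone is enough. *)
Lemma powR_taylor2 p s t : 0 < p -> 0 < s -> 0 <= s + t ->
  (s + t) `^ p <= s `^ p * (1 + p * (t / s) + 2 * p ^+ 2 * (t / s) ^+ 2)
                  + (2 * p + 1) `^ p * `|t| `^ p.
Proof.
move=> p0 s0 st0; set y := t / s.
have tE : t = s * y by rewrite /y mulrC divfK// gt_eqF.
have y1 : 0 <= 1 + y by rewrite -(pmulr_rge0 _ s0) mulrDr mulr1 -tE.
have -> : s + t = s * (1 + y) by rewrite tE; ring.
rewrite powRM// ?(ltW s0)//.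
have sp0 : 0 <= s `^ p by exact: powR_ge0.
have [py|py] := leP (p * y) 2^-1.
  rewrite -[leLHS]addr0 lerD ?mulr_ge0 ?powR_ge0//.
  rewrite ler_wpM2l//.
  apply: (@le_trans _ _ (expR (p * y))).
    by rewrite mulrC expRM ge0_ler_powR ?nnegrE ?expR_ge0 ?(ltW p0) ?expR_ge1Dx.
  by rewrite (le_trans (expR_le_quadratic py))//; lra.
have y0 : 0 < y by rewrite -(pmulr_rgt0 _ p0); lra.
have t0 : 0 < t by rewrite tE mulr_gt0.
rewrite -[leLHS]add0r lerD//.
  have y2 := sqr_ge0 y; rewrite mulr_ge0//; nra.
have [p0' t0' s0'] := And3 (ltW p0) (ltW t0) (ltW s0).
have p1 : 0 <= 2 * p + 1 by lra.
rewrite gtr0_norm// -!powRM// ge0_ler_powR ?nnegrE ?mulr_ge0//.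
by rewrite tE mulrCA ler_pM2l//; nra.
Qed.

Lemma powR_add_le x y p : 0 <= x -> 0 <= y -> 0 <= p ->
  (x + y) `^ p <= 2 `^ p * (x `^ p + y `^ p).
Proof.
move=> x0 y0 p0.
wlog xy : x y x0 y0 / x <= y.
  move=> W; case: (leP x y) => [|/ltW] h; first exact: W.
  by rewrite addrC [_ `^ p + _]addrC; exact: W.
apply: (@le_trans _ _ ((2 * y) `^ p)).
  by rewrite ge0_ler_powR ?nnegrE ?addr_ge0 ?mulr_ge0// mulr_natl mulr2n lerD2r.
by rewrite powRM// ler_wpM2l ?powR_ge0// lerDr powR_ge0.
Qed.

End real_inequalities.

(** * The log-sum-exp potential *)

Section log_sum_exp.
Context {R : realType} {J : finType}.
Implicit Types u v : J -> R.

Definition cosh_sum u : R := \sum_j (expR (u j) + expR (- u j)).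

(** A smooth substitute for the maximum of the |u j|.  The summand 1 keeps it above 1,
so that it dominates its own lower powers. *)
Definition lse u : R := 1 + ln (cosh_sum u).

(** The minimum of lse, attained at 0; it is the log-cardinality of J up to
constants. *)
Definition lse_floor : R := 1 + ln (2 * #|J|%:R).

Definition lse_grad u j : R := (expR (u j) - expR (- u j)) / cosh_sum u.

Hypothesis J0 : (0 < #|J|)%N.

Lemma cosh_sum_ge u : 2 * #|J|%:R <= cosh_sum u.
Proof.
rewrite /cosh_sum -sum1_card natr_sum mulr_sumr ler_sum// => j _.
by have := expR_ge1Dx (u j); have := expR_ge1Dx (- u j); lra.
Qed.

Let card2_gt0 : 0 < 2 * #|J|%:R :> R.
Proof. by rewrite mulr_gt0 ?ltr0n. Qed.

Let card2_ge1 : 1 <= 2 * #|J|%:R :> R.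
Proof. by rewrite -natrM ler1n muln_gt0. Qed.

Lemma cosh_sum_gt0 u : 0 < cosh_sum u.
Proof. by rewrite (lt_le_trans _ (cosh_sum_ge u)). Qed.

Lemma lse_floor_ge1 : 1 <= lse_floor.
Proof. by rewrite lerDl ln_ge0. Qed.

Lemma lse_ge_floor u : lse_floor <= lse u.
Proof. by rewrite lerD2l ler_ln ?posrE ?cosh_sum_gt0 ?cosh_sum_ge. Qed.

Lemma lse0 : lse (fun=> 0) = lse_floor.
Proof.
rewrite /lse /cosh_sum; congr (1 + ln _).
by under eq_bigr do rewrite oppr0 expR0; rewrite sumr_const mulr_natr.
Qed.

Lemma le_lse u j : `|u j| <= lse u.
Proof.
have le_ln (v : R) : v <= 1 + ln (expR v) by rewrite expRK; lra.
have [u0|u0] := ger0P (u j); apply: (le_trans (le_ln _)); rewrite lerD2l.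
- rewrite ler_ln ?posrE ?expR_gt0 ?cosh_sum_gt0// /cosh_sum (bigD1 j)//=.
  by rewrite -addrA lerDl addr_ge0 ?expR_ge0// sumr_ge0.
- rewrite ler_ln ?posrE ?expR_gt0 ?cosh_sum_gt0// /cosh_sum (bigD1 j)//=.
  by rewrite addrAC lerDr addr_ge0 ?expR_ge0// sumr_ge0.
Qed.

Lemma lse_lipschitz u v (D : R) : (forall j, `|v j| <= D) ->
  lse (u \+ v) <= lse u + D.
Proof.
move=> vD; rewrite /lse -addrA lerD2l -[X in _ + X]expRK.
rewrite -lnM ?posrE ?expR_gt0 ?cosh_sum_gt0//.
rewrite ler_ln ?posrE ?mulr_gt0 ?expR_gt0 ?cosh_sum_gt0//.
rewrite /cosh_sum mulr_suml ler_sum// => j _; rewrite mulrDl opprD !expRD.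
have := vD j; rewrite ler_norml => /andP[vD1 vD2].
by rewrite lerD// ler_wpM2l ?expR_ge0// ler_expR; lra.
Qed.

Lemma lse_lipschitzN u v (D : R) : (forall j, `|v j| <= D) ->
  lse u - D <= lse (u \+ v).
Proof.
move=> vD; rewrite lerBlDr.
have /lse_lipschitz -/(_ (u \+ v)) : forall j, `|- v j| <= D.
  by move=> j; rewrite normrN.
by congr (_ <= _); congr lse; apply/funext => j /=; rewrite addrK.
Qed.

Lemma lse_grad_ge u v (D : R) : (forall j, `|v j| <= D) ->
  - D <= \sum_j lse_grad u j * v j.
Proof.
move=> vD.
suff : `|\sum_j lse_grad u j * v j| <= D by rewrite ler_norml => /andP[].
apply: (le_trans (ler_norm_sum _ _ _)).
have -> : D = \sum_j (expR (u j) + expR (- u j)) / cosh_sum u * D.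
  by rewrite -mulr_suml -mulr_suml divff ?mul1r// gt_eqF// cosh_sum_gt0.
apply: ler_sum => j _; rewrite normrM ler_pM// normrM.
rewrite [X in _ * X]gtr0_norm ?invr_gt0 ?cosh_sum_gt0//.
rewrite ler_pM2r ?invr_gt0 ?cosh_sum_gt0//.
by rewrite (le_trans (ler_normB _ _))// !ger0_norm// expR_ge0.
Qed.

(** The second derivative of lse in the direction v is at most the square of the sup
norm of v, whatever the cardinality of J.  For D <= 1/2 the quadratic bound of exp is
averaged with the weights exp (+- u j) / cosh_sum u; for D > 1/2 the Lipschitz bound
is already smaller than the right-hand side, since then 2 * D <= 4 * D ^+ 2. *)
Lemma lse_quadratic u v (D : R) : (forall j, `|v j| <= D) -> 0 <= D ->
  lse (u \+ v) <= lse u + \sum_j lse_grad u j * v j + 4 * D ^+ 2.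
Proof.
move=> vD D0; have Z0 := cosh_sum_gt0 u.
have [D2|D2] := leP D 2^-1; last first.
  have := lse_lipschitz u vD; have := lse_grad_ge u vD; nra.
pose G := 1 + \sum_j lse_grad u j * v j + 2 * D ^+ 2.
suff Zle : cosh_sum (u \+ v) <= cosh_sum u * G.
  have pos : 0 < G.
    by rewrite -(pmulr_rgt0 _ Z0) (lt_le_trans (cosh_sum_gt0 (u \+ v))).
  rewrite /lse -!addrA lerD2l; apply: (@le_trans _ _ (ln (cosh_sum u * G))).
    by rewrite ler_ln ?posrE ?cosh_sum_gt0// mulr_gt0.
  rewrite lnM ?posrE// lerD2l; rewrite /G -addrA in pos *.
  rewrite (le_trans (le_ln1Dx _))//; first by lra.
  by rewrite lerD2l; nra.
rewrite /G mulrDr mulrDr mulr1 mulr_sumr /cosh_sum -/(cosh_sum u).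
rewrite mulr_suml -!big_split/=.
apply: ler_sum => j _.
rewrite mulrA /lse_grad [X in _ + X * v j + _]mulrC divfK ?gt_eqF//.
have := vD j; rewrite ler_norml => /andP[vD1 vD2].
have v2 : v j ^+ 2 <= D ^+ 2 by nra.
have e1 : expR (v j) <= 1 + v j + 2 * D ^+ 2.
  by rewrite (le_trans (expR_le_quadratic _))//; lra.
have e2 : expR (- v j) <= 1 - v j + 2 * D ^+ 2.
  by rewrite (le_trans (expR_le_quadratic _))// ?sqrrN; lra.
rewrite opprD !expRD.
have := ler_wpM2l (expR_ge0 (u j)) e1; have := ler_wpM2l (expR_ge0 (- u j)) e2.
lra.
Qed.

End log_sum_exp.
Arguments lse_floor {R} J.

Section potential_step.
Context {R : realType} {J : finType}.
Implicit Types (p : R) (n : nat).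

(** The scale that balances n quadratic increments of lse, of size lse_scale ^+ 2
each, with its starting value lse_floor. *)
Definition lse_scale n : R := Num.sqrt (lse_floor J / n%:R).

Lemma lse_scale_ge0 n : 0 <= lse_scale n.
Proof. exact: sqrtr_ge0. Qed.

Definition lse_step_cst p : R := 4 * p + 2 * p ^+ 2 + (2 * p + 1) `^ p.

(** Apart from the term linear in x, which has mean zero for a centred x, a step
changes lse ^ p by a relative amount of order 1 / n.  The envelope D enters through
D ^ 2 and D ^ p only, so that p moments of D are enough.  The three nonlinear terms
are absorbed with lse_scale ^+ 2 = lse_floor / n, lse_floor <= lse u and
1 <= lse u. *)
Lemma lse_powR_step p n (u x : J -> R) (D : R) :
  (0 < #|J|)%N -> 2 <= p -> (0 < n)%N -> 0 <= D -> (forall j, `|x j| <= D) ->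
  lse (fun j => u j + lse_scale n * x j) `^ p <=
    lse u `^ p * (1 + p * lse_scale n / lse u * (\sum_j lse_grad u j * x j)
                  + lse_step_cst p / n%:R * (1 + D `^ p)).
Proof.
move=> J0 p2 n0 D0 xD; set l : R := lse_floor J; set lam := lse_scale n.
 set s := lse u; set t := lse (fun j => u j + lam * x j) - s.
have n1 : 1 <= n%:R :> R by rewrite ler1n.
have n0' : 0 < n%:R :> R by rewrite ltr0n.
have l1 : 1 <= l by exact: lse_floor_ge1.
have ls : l <= s by exact: lse_ge_floor.
have lam0 : 0 <= lam by exact: sqrtr_ge0.
have lam2 : lam ^+ 2 = l / n%:R.
  by rewrite sqr_sqrtr// divr_ge0// (le_trans _ l1).
have s0 : 0 < s by lra.
have lxD j : `|lam * x j| <= lam * D by rewrite normrM ger0_norm ?ler_wpM2l.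
have tD : `|t| <= lam * D.
  rewrite ler_norml /t; have := lse_lipschitz J0 u lxD.
  have := lse_lipschitzN J0 u lxD; rewrite -/s => ? ?; apply/andP; split; lra.
have tq : t <= lam * (\sum_j lse_grad u j * x j) + 4 * (lam * D) ^+ 2.
  have := lse_quadratic J0 u lxD (mulr_ge0 lam0 D0).
  rewrite -/s mulr_sumr /t => h; rewrite lerBlDl addrA (le_trans h)//.
  by rewrite lerD2r lerD2l ler_sum// => j _; rewrite mulrCA.
have st : s + t = lse (fun j => u j + lam * x j) by rewrite /t addrC subrK.
have st0 : 0 <= s + t by rewrite st (le_trans _ (lse_ge_floor J0 _))// -/l; lra.
have p0' : 0 < p by lra.
rewrite -st (le_trans (powR_taylor2 p0' s0 st0))//.
set g := \sum_j _ in tq *.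
have sp0 : 0 <= s `^ p by exact: powR_ge0.
have lamn : lam ^+ 2 <= s / n%:R by rewrite lam2 ler_pM2r ?invr_gt0.
have D2 : D ^+ 2 <= 1 + D `^ p.
  have [D1|D1] := leP D 1.
    by have := powR_ge0 D p; nra.
  by rewrite -powR_mulrn// (le_trans (ler_powR (ltW D1) p2)) ?lerDr.
set X := n%:R^-1 * (1 + D `^ p).
have lamD : lam ^+ 2 * D ^+ 2 <= s * X.
  by rewrite /X [s * _]mulrA ler_pM ?sqr_ge0.
have h1 : t / s <= lam / s * g + 4 * X.
  rewrite ler_pdivrMr// mulrDl mulrAC divfK ?gt_eqF// (le_trans tq)// lerD2l.
  by rewrite exprMn; lra.
have h2 : (t / s) ^+ 2 <= X.
  have t2 : t ^+ 2 <= lam ^+ 2 * D ^+ 2.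
    by rewrite -exprMn -[t ^+ 2]real_normK ?num_real// lerXn2r ?nnegrE ?mulr_ge0.
  have sX : 0 <= s * X by rewrite (le_trans _ lamD)// mulr_ge0 ?sqr_ge0.
  by rewrite exprMn exprVn ler_pdivrMr ?exprn_gt0// (le_trans t2)//; nra.
have h3 : `|t| `^ p <= s `^ p * X.
  apply: (@le_trans _ _ ((lam * D) `^ p)).
    by rewrite ge0_ler_powR ?nnegrE ?mulr_ge0//; lra.
  rewrite powRM// /X mulrA ler_pM ?powR_ge0 ?lerDr//.
  have -> : lam `^ p = l `^ (p / 2) * n%:R^-1 `^ (p / 2).
    rewrite -powRM ?invr_ge0//; last by lra.
    by rewrite -lam2 -powR_mulrn// -powRrM; congr (_ `^ _); field.
  rewrite ler_pM ?powR_ge0//.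
    rewrite (le_trans (ler_powR l1 (_ : _ <= p)))//; first by lra.
    by rewrite ge0_ler_powR ?nnegrE//; lra.
  rewrite ge1r_powR// ?invr_gt0 ?n0' ?invf_le1//.
  by lra.
have p0 := ltW p0'.
rewrite mulrDr mulrDr mulr1 /lse_step_cst.
have q0 : 0 <= (2 * p + 1) `^ p by exact: powR_ge0.
have := ler_wpM2l (mulr_ge0 sp0 p0) h1.
have := ler_wpM2l (mulr_ge0 sp0 (sqr_ge0 p)) h2.
have := ler_wpM2l q0 h3.
have -> : (4 * p + 2 * p ^+ 2 + (2 * p + 1) `^ p) / n%:R * (1 + D `^ p)
  = (4 * p + 2 * p ^+ 2 + (2 * p + 1) `^ p) * X by rewrite /X; ring.
have -> : p * lam / s * g = p * (lam / s * g) by ring.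
lra.
Qed.

Lemma lse_step_cst_ge0 p : 2 <= p -> 0 <= lse_step_cst p.
Proof. by move=> p2; have := powR_ge0 (2 * p + 1) p; rewrite /lse_step_cst; nra. Qed.

End potential_step.
Arguments lse_scale {R} J n.

Section potential_integral.
Context {R : realType} {J : finType} d (T : measurableType d).

Lemma measurable_lse (f : J -> T -> R) :
  (forall j, measurable_fun setT (f j)) ->
  measurable_fun setT (fun t => lse (f ^~ t)).
Proof.
move=> mf; apply: measurable_funD => //; apply: measurableT_comp => //.
apply: measurable_sum => j; apply: measurable_funD.
  by apply: measurableT_comp => //; exact: mf.
by apply: measurableT_comp => //; apply: measurableT_comp => //; exact: mf.
Qed.

(** The expectation of lse_powR_step: the linear term integrates to zero. *)
Lemma integral_lse_step (mu : probability T R) (p K : R) n (D : T -> R)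
    (x : J -> T -> R) (u : J -> R) :
  (0 < #|J|)%N -> 2 <= p -> (0 < n)%N ->
  measurable_fun setT D -> (forall t, 0 <= D t) ->
  (\int[mu]_t (1 + D t `^ p)%:E <= K%:E)%E ->
  (forall j, mu.-integrable setT (EFin \o x j)) ->
  (forall j, \int[mu]_t (x j t)%:E = 0)%E ->
  (forall j t, `|x j t| <= D t) ->
  (\int[mu]_t (lse (fun j => u j + lse_scale J n * x j t) `^ p)%:E <=
    (lse u `^ p * (1 + lse_step_cst p * K / n%:R))%:E)%E.
Proof.
move=> J0 p2 n0 mD D0 DK ix x0 xD.
have mx j : measurable_fun setT (x j) by apply/measurable_EFinP/(measurable_int mu).
have ixZ j (k : R) : mu.-integrable setT (fun t => (k%:E * (x j t)%:E)%E).
  exact: (@integrableZl _ _ _ _ _ measurableT k _ (ix j)).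
have mDp : measurable_fun setT (fun t => 1 + D t `^ p).
  by apply: measurable_funD => //; exact: measurableT_comp (measurable_powR p) mD.
have Dp0 t : 0 <= 1 + D t `^ p by rewrite addr_ge0 ?powR_ge0.
have iD : mu.-integrable setT (EFin \o (fun t => 1 + D t `^ p)).
  apply/integrableP; split; first exact/measurable_EFinP.
  under eq_integral => t _ do rewrite /= ger0_norm//.
  exact: le_lt_trans DK (ltry _).
set s := lse u `^ p.
pose beta j := s * (p * lse_scale J n / lse u * lse_grad u j).
pose L t := \sum_j beta j * x j t.
have LE t : (L t)%:E = (\sum_j (beta j)%:E * (x j t)%:E)%E by rewrite sumEFin.
have iL : mu.-integrable setT (EFin \o L).
  rewrite (_ : _ \o _ = fun t => (\sum_j (beta j)%:E * (x j t)%:E)%E).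
    by apply: integrable_sum => // j _; exact: ixZ.
  by apply/funext => t; exact: LE.
have L0 : (\int[mu]_t (L t)%:E = 0)%E.
  under eq_integral do rewrite LE.
  rewrite integral_sum//=.
  rewrite big1// => j _.
  by rewrite (integralZl measurableT (ix j)) [X in (_ * X)%E]x0 mule0.
pose c := s * (lse_step_cst p / n%:R).
have s0 : 0 <= s by exact: powR_ge0.
have c0 : 0 <= c by rewrite mulr_ge0// divr_ge0// lse_step_cst_ge0.
have icD : mu.-integrable setT (fun t => (c%:E * (1 + D t `^ p)%:E)%E).
  exact: (@integrableZl _ _ _ _ _ measurableT c _ iD).
have is_ : mu.-integrable setT (cst s%:E) by exact: finite_measure_integrable_cst.
have mS : measurable_fun setT (fun t => lse (fun j => u j + lse_scale J n * x j t)).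
  apply: measurable_lse => j; apply: measurable_funD => //.
  by apply: measurable_funM.
apply: (@le_trans _ _ (\int[mu]_t (s%:E + (L t)%:E + c%:E * (1 + D t `^ p)%:E))%E).
  have iR : mu.-integrable setT
      (fun t => (s%:E + (L t)%:E + c%:E * (1 + D t `^ p)%:E)%E).
    by apply: integrableD => //; exact: integrableD.
  apply: ge0_le_integral.
  - exact: measurableT.
  - by move=> t _; rewrite lee_fin powR_ge0.
  - apply/measurable_EFinP; apply: measurableT_comp (measurable_powR p) _.
    exact: mS.
  - exact: measurable_int iR.
  - move=> t _; rewrite -!EFinM -!EFinD lee_fin.
    rewrite (le_trans (lse_powR_step u J0 p2 n0 (D0 t) (xD ^~ t)))// -/s.
    have -> : L t = s * (p * lse_scale J n / lse u * \sum_j lse_grad u j * x j t).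
      by rewrite !mulr_sumr; apply: eq_bigr => j _; rewrite /beta !mulrA.
    by rewrite /c !mulrDr mulr1 !mulrA.
rewrite integralD//=; last exact: integrableD.
rewrite integralD//= L0 adde0 integral_cst//= probability_setT mule1.
rewrite integralZl// mulrDr mulr1 EFinD leeD2l//.
have -> : s * (lse_step_cst p * K / n%:R) = c * K by rewrite /c; ring.
by rewrite [leRHS]EFinM; apply: lee_wpmul2l; rewrite ?lee_fin.
Qed.

End potential_integral.

(** * Independent observations *)

Section independence.
Context d d1 d2 (Omega : measurableType d) (T1 : measurableType d1)
  (T2 : measurableType d2) (R : realType).

Lemma integral_indep_pair (P : probability Omega R) (U : {mfun Omega >-> T1})
    (V : {mfun Omega >-> T2}) (h : T1 * T2 -> \bar R) :
  (forall A B, measurable A -> measurable B ->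
    P (U @^-1` A `&` V @^-1` B) = (P (U @^-1` A) * P (V @^-1` B))%E) ->
  measurable_fun setT h -> (forall z, 0 <= h z)%E ->
  (\int[P]_w h (U w, V w) =
   \int[distribution P U]_s \int[distribution P V]_t h (s, t))%E.
Proof.
move=> UV mh h0.
have mUV : measurable_fun setT (fun w => (U w, V w)).
  exact: measurable_fun_pair.
transitivity (\int[pushforward P (fun w => (U w, V w))]_z h z)%E.
  by rewrite ge0_integral_pushforward// => z _; exact: h0.
rewrite -fubini_tonelli1//.
apply: eq_measure_integral => /= A mA _; apply/esym.
pose m' := pushforward P (fun w => (U w, V w)).
exact: (@product_measure_unique _ _ _ _ _ (distribution P U) (distribution P V) m').
Qed.

End independence.

Section past.
Context d dY (Omega : measurableType d) (YY : measurableType dY) (R : realType)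
  (P : probability Omega R) (Ys : nat -> {RV P >-> YY}).
Hypothesis indep : independent_seq Ys.

Definition cylinder (s : seq nat) (A : nat -> set YY) : set Omega :=
  \big[setI/setT]_(i <- s) (Ys i @^-1` A i).

(** The pi-system generating the past of time i.  The sigma-algebra is kept on Omega
itself, so that Fubini applies to the pair made of the identity, with this
sub-sigma-algebra on the target, and of the next observation. *)
Definition past_cylinders (i : nat) : set (set Omega) :=
  [set cylinder (iota 0 i) A | A in [set A | forall l, measurable (A l)]].

Lemma measurable_cylinder s A : (forall l, measurable (A l)) ->
  measurable (cylinder s A).
Proof.
move=> mA; apply: bigsetI_measurable => l _.
by rewrite -[X in measurable X]setTI; exact: measurable_funP.
Qed.

Lemma past_cylinders_setT i : past_cylinders i setT.
Proof.
exists (fun=> setT) => //; rewrite /cylinder.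
by rewrite big1// => l _; rewrite preimage_setT.
Qed.

Lemma past_indep i (E : set Omega) (B : set YY) :
  <<s past_cylinders i >> E -> measurable B ->
  P (E `&` Ys i @^-1` B) = (P E * P (Ys i @^-1` B))%E.
Proof.
move=> sE mB.
have mYB : measurable (Ys i @^-1` B).
  by rewrite -[X in measurable X]setTI; exact: measurable_funP.
pose r := NngNum (fine_ge0 (measure_ge0 P (Ys i @^-1` B))).
have rE : (r%:num)%:E = P (Ys i @^-1` B) by rewrite /= fineK ?fin_num_measure.
suff : mrestr P mYB E = mscale r P E by rewrite /mrestr /mscale rE muleC.
apply: (@g_sigma_algebra_measure_unique _ _ _ (past_cylinders i) _ (fun=> setT)) => //.
- by move=> _ [A mA <-]; exact: measurable_cylinder.
- by move=> _; exact: past_cylinders_setT.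
- by apply/seteqP; split => // w _; exists 0%N.
- move=> _ _ [A mA <-] [A' mA' <-]; exists (fun l => A l `&` A' l).
    by move=> l; exact: measurableI.
  by rewrite /cylinder -big_split/=; apply: eq_bigr => l _; rewrite preimage_setI.
- move=> _ [A mA <-]; rewrite /= /mscale /mrestr rE muleC.
  pose A' l := if l == i then B else A l.
  have mA' l : measurable (A' l) by rewrite /A'; case: ifP.
  have agree l : (l \in iota 0 i) -> A' l = A l.
    by rewrite mem_iota add0n /A' => /andP[_]; case: eqP => // ->; rewrite ltnn.
  have := indep (iota_uniq 0 i.+1) mA'.
  rewrite -addn1 iotaD !big_cat/= !big_seq1 add0n /A' eqxx -/(A').
  rewrite (@eq_big_seq _ _ _ _ _ (fun l => Ys l @^-1` A' l)
    (fun l => Ys l @^-1` A l)); last by move=> l /agree ->.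
  rewrite -/(cylinder _ _) => ->; congr (_ * _)%E.
  rewrite /cylinder (indep (iota_uniq 0 i) mA) !big_seq.
  by apply: eq_bigr => l /agree; rewrite /A' => ->.
- by move=> k /=; rewrite /mrestr setTI ltey_eq fin_num_measure.
Qed.

End past.

Section lse_random_walk.
Context d dY (Omega : measurableType d) (YY : measurableType dY) (R : realType)
  (P : probability Omega R) (Y : {RV P >-> YY}) (Ys : nat -> {RV P >-> YY}).
Context {J : finType}.

Lemma measurable_past (i l : nat) : (l < i)%N ->
  measurable_fun setT (Ys l : g_sigma_algebraType (past_cylinders Ys i) -> YY).
Proof.
move=> li _ B mB; rewrite setTI; apply: sub_sigma_algebra.
exists (fun k => if k == l then B else setT); first by move=> k; case: ifP.
rewrite /cylinder (bigD1_seq l) ?iota_uniq ?mem_iota//= eqxx big1 ?setIT//.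
by move=> k /negPf ->; rewrite preimage_setT.
Qed.

(** The maximal inequality.  Conditionally on the past, integral_lse_step multiplies
the moment of the potential by at most 1 + C / n; the bound exp C after n steps does
not depend on n, and J enters through lse_floor only. *)
Lemma integral_lse_walk (p K : R) n (D : YY -> R) (x : J -> YY -> R) :
  independent_seq Ys -> (forall i, same_law (Ys i) Y) ->
  (0 < #|J|)%N -> 2 <= p -> (0 < n)%N ->
  measurable_fun setT D -> (forall t, 0 <= D t) ->
  (\int[distribution P Y]_t (1 + D t `^ p)%:E <= K%:E)%E ->
  (forall j, (distribution P Y).-integrable setT (EFin \o x j)) ->
  (forall j, \int[distribution P Y]_t (x j t)%:E = 0)%E ->
  (forall j t, `|x j t| <= D t) ->
  (\int[P]_w (lse (fun j => lse_scale J n * \sum_(l < n) x j (Ys l w)) `^ p)%:E <=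
    (expR (lse_step_cst p * K) * lse_floor J `^ p)%:E)%E.
Proof.
move=> indep law J0 p2 n0 mD D0 DK ix x0 xD.
have mx j : measurable_fun setT (x j).
  by apply/measurable_EFinP/(measurable_int (distribution P Y)).
have K0 : 0 <= K.
  rewrite -lee_fin (le_trans _ DK)// integral_ge0// => t _.
  by rewrite lee_fin addr_ge0 ?powR_ge0.
have q0 : 0 <= lse_step_cst p * K / n%:R by rewrite divr_ge0// mulr_ge0// lse_step_cst_ge0.
pose walk i w j := lse_scale J n * \sum_(l < i) x j (Ys l w).
suff walk_le i : (\int[P]_w (lse (walk i w) `^ p)%:E <=
    ((1 + lse_step_cst p * K / n%:R) ^+ i * lse_floor J `^ p)%:E)%E.
  rewrite (le_trans (walk_le n))// lee_fin ler_wpM2r ?powR_ge0//.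
  have -> : expR (lse_step_cst p * K) = expR (lse_step_cst p * K / n%:R) ^+ n.
    by rewrite -expRM_natl [n%:R * _]mulrC divfK// pnatr_eq0 -lt0n.
  by rewrite lerXn2r ?nnegrE ?expR_ge0 ?addr_ge0// expR_ge1Dx.
elim: i => [|i IH].
  rewrite expr0 mul1r -lse0.
  under eq_integral => w _.
    rewrite (_ : walk 0 w = fun=> 0); last first.
      by apply/funext => j; rewrite /walk big_ord0 mulr0.
    over.
  by rewrite integral_cst//= probability_setT mule1.
pose T1 := g_sigma_algebraType (past_cylinders Ys i).
have sub_past : <<s past_cylinders Ys i >> `<=` @measurable _ Omega.
  apply: smallest_sub; first exact: sigma_algebra_measurable.
  by move=> _ [A mA <-]; exact: measurable_cylinder.
have mid : measurable_fun setT (idfun : Omega -> T1).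
  by move=> _ A mA; rewrite setTI; exact: sub_past.
pose U : {mfun Omega >-> T1} := HB.pack (idfun : Omega -> T1)
  (isMeasurableFun.Build _ _ _ _ _ mid).
have mwalk : measurable_fun setT (fun s : T1 => lse (walk i s)).
  apply: measurable_lse => j; apply: measurable_funM => //.
  apply: measurable_sum => l; apply: (measurableT_comp (mx j)).
  exact: measurable_past.
pose h (z : T1 * YY) : \bar R :=
  (lse (fun j => walk i z.1 j + lse_scale J n * x j z.2) `^ p)%:E.
have mh : measurable_fun setT h.
  apply/measurable_EFinP; apply: (measurableT_comp (measurable_powR p)).
  apply: measurable_lse => j; apply: measurable_funD.
    apply: measurable_funM => //.
    apply: measurable_sum => l; apply: (measurableT_comp (mx j)).
    by apply: (measurableT_comp (measurable_past (ltn_ord l))); exact: measurable_fst.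
  apply: measurable_funM => //; apply: (measurableT_comp (mx j)).
  exact: measurable_snd.
have h0 z : (0 <= h z)%E by rewrite lee_fin powR_ge0.
have UV A B : measurable A -> measurable B ->
    P (U @^-1` A `&` Ys i @^-1` B) = (P (U @^-1` A) * P (Ys i @^-1` B))%E.
  by move=> mA mB; exact: past_indep.
have walkS w :
    lse (walk i.+1 w) = lse (fun j => walk i w j + lse_scale J n * x j (Ys i w)).
  by congr lse; apply/funext => j; rewrite /walk big_ord_recr/= mulrDr.
under eq_integral do rewrite walkS.
have -> := integral_indep_pair UV mh h0.
set q := 1 + _ in IH *.
have q1 : 0 <= q by rewrite addr_ge0.
apply: (@le_trans _ _ (\int[distribution P U]_s (q%:E * (lse (walk i s) `^ p)%:E))%E).
  apply: ge0_le_integral.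
  - exact: measurableT.
  - by move=> s _; apply: integral_ge0 => t _; exact: h0.
  - exact: measurable_fun_fubini_tonelli_F.
  - apply: measurable_funeM; apply/measurable_EFinP.
    exact: (measurableT_comp (measurable_powR p)).
  - move=> s _.
    rewrite (@eq_measure_integral _ _ _ _ (distribution P Y)); last first.
      by move=> A mA _; exact: law.
    rewrite (le_trans (integral_lse_step (walk i s) J0 p2 n0 mD D0 DK ix x0 xD))//.
    by rewrite -EFinM mulrC.
have mS : measurable_fun setT (fun s : T1 => (lse (walk i s) `^ p)%:E).
  by apply/measurable_EFinP; exact: (measurableT_comp (measurable_powR p)).
have S0 (s : T1) : (0 <= (lse (walk i s) `^ p)%:E)%E by rewrite lee_fin powR_ge0.
rewrite (ge0_integralZl_EFin _ measurableT (fun s _ => S0 s) mS q1).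
rewrite (ge0_integral_distribution U mS S0).
rewrite exprS -mulrA [leRHS]EFinM.
by apply: lee_wpmul2l; rewrite ?lee_fin.
Qed.

End lse_random_walk.

(** * The envelope of the quadruple inequality *)

Section reference_point.
Context d dY (Omega : measurableType d) (YY : measurableType dY) (R : realType)
  (P : probability Omega R) (Y Y' : {RV P >-> YY}).

Lemma moment_lty (a : YY -> YY -> R) (zeta : R) : (forall y z, 0 <= a y z) ->
  0 < zeta -> (moment a Y' Y zeta < +oo)%E ->
  (\int[P]_w (a (Y' w) (Y w) `^ Num.max 2 zeta)%:E < +oo)%E.
Proof.
move=> a0 z0; rewrite /moment unlock.
have [z2|z2] := leP 2 zeta; first by [].
move=> h.
under eq_integral do rewrite powR_mulrn//.
by apply: lty_poweRy h; rewrite mulf_neq0// gt_eqF// ltr0n.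
Qed.

(** Freezing the second argument of a gives an envelope that is finite everywhere,
whereas the mean of a (y, Y) may be infinite for some y.  If no point had a finite
moment, Fubini would make the double integral infinite. *)
Lemma exists_reference_point (a : YY -> YY -> R) (p : R) :
  same_law Y' Y -> independent_pair Y' Y ->
  measurable_fun setT (fun yz : YY * YY => a yz.1 yz.2) ->
  (\int[P]_w (a (Y' w) (Y w) `^ p)%:E < +oo)%E ->
  exists z, (\int[distribution P Y]_y (a y z `^ p)%:E < +oo)%E.
Proof.
move=> law indep ma fin; apply/not_existsP => infty.
pose h (z : YY * YY) : \bar R := (a z.2 z.1 `^ p)%:E.
have mh : measurable_fun setT h.
  apply/measurable_EFinP; apply: (measurableT_comp (measurable_powR p)).
  have mswap : measurable_fun setT (fun z : YY * YY => (z.2, z.1)).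
    exact: measurable_swap.
  exact: (measurableT_comp ma mswap).
have h0 z : (0 <= h z)%E by rewrite lee_fin powR_ge0.
have YY' A B : measurable A -> measurable B ->
    P (Y @^-1` A `&` Y' @^-1` B) = (P (Y @^-1` A) * P (Y' @^-1` B))%E.
  by move=> mA mB; rewrite setIC indep// muleC.
suff : (\int[P]_w (a (Y' w) (Y w) `^ p)%:E = +oo)%E by move=> e; rewrite e in fin.
rewrite -[LHS]/(\int[P]_w h (Y w, Y' w))%E (integral_indep_pair YY' mh h0).
under eq_integral => z _.
  rewrite (@eq_measure_integral _ _ _ _ (distribution P Y)); last first.
    by move=> A mA _; exact: law.
  have -> : (\int[distribution P Y]_t h (z, t) = +oo)%E.
    by apply/eqP; rewrite -leye_eq leNgt; apply/negP; exact: infty.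
  over.
by rewrite integral_cst//= probability_setT mule1.
Qed.

End reference_point.

Section shifted_moment.
Context dY (YY : measurableType dY) (R : realType) (mu : probability YY R).

Lemma integral_shift_powR_lty (A : YY -> R) (s p : R) : 0 <= p -> 0 <= s ->
  measurable_fun setT A -> (forall y, 0 <= A y) ->
  (\int[mu]_y (A y `^ p)%:E < +oo)%E ->
  (\int[mu]_y (1 + (A y + s) `^ p)%:E < +oo)%E.
Proof.
move=> p0 s0 mA A0 Ap.
have mAp (t : R) : measurable_fun setT (fun y => (A y + t) `^ p).
  apply: (measurableT_comp (measurable_powR p)).
  by apply: measurable_funD.
have mAp0 : measurable_fun setT (fun y => A y `^ p).
  exact: (measurableT_comp (measurable_powR p)).
apply: (@le_lt_trans _ _ (\int[mu]_y
    ((1 + 2 `^ p * s `^ p)%:E + (2 `^ p)%:E * (A y `^ p)%:E))%E).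
  apply: ge0_le_integral.
  - exact: measurableT.
  - by move=> y _; rewrite lee_fin addr_ge0 ?powR_ge0.
  - by apply/measurable_EFinP; apply: measurable_funD.
  - apply/measurable_EFinP; apply: measurable_funD => //.
    exact: measurable_funM.
  - move=> y _; rewrite lee_fin; have := powR_add_le (A0 y) s0 p0.
    rewrite mulrDr; lra.
rewrite ge0_integralD//=.
- rewrite integral_cst//= ge0_integralZl_EFin ?powR_ge0//=.
  + by rewrite probability_setT mule1 lte_add_pinfty ?ltry// lte_mul_pinfty//
      lee_fin powR_ge0.
  + by move=> y _; rewrite lee_fin powR_ge0.
  + exact/measurable_EFinP.
- by move=> y _; rewrite lee_fin addr_ge0 ?mulr_ge0 ?powR_ge0.
- by move=> y _; rewrite lee_fin ?mulr_ge0 ?powR_ge0.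
- by apply/measurable_EFinP; exact: measurable_funM.
Qed.

End shifted_moment.

(** * Normalized deviations of the empirical cost *)

(** The last coordinate, A - EA, makes the potential control also the empirical mean
of the envelope, hence the Lipschitz constant of the empirical cost.  When
b m (q i) = 0 the convention 0^-1 = 0 makes the quotient vanish; so does its
numerator, which is bounded by a multiple of b m (q i). *)
Definition deviation {R : realType} {Q YY : Type} (b : Q -> Q -> R)
    (c : YY -> Q -> R) (F : Q -> R) (A : YY -> R) (EA : R) (k : nat)
    (q : 'I_k -> Q) (m : Q) (j : option 'I_k) (z : YY) : R :=
  if j is Some i then ((c z (q i) - F (q i)) - (c z m - F m)) / b m (q i)
  else A z - EA.

Section deviation_integral.
Context dY (YY : measurableType dY) (R : realType) (mu : probability YY R).

Let muT : fine (mu setT) = 1. Proof. by rewrite probability_setT. Qed.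

(** The hypothesis compares f - g with its value s at a reference point, so that the
mean of f - g is itself within beta times the mean of A of s. *)
Lemma centred_lipschitz (f g A : YY -> R) (s beta : R) :
  mu.-integrable setT (EFin \o f) -> mu.-integrable setT (EFin \o g) ->
  mu.-integrable setT (EFin \o A) ->
  (forall y, `|(f y - g y) - s| <= A y * beta) -> forall y,
  `|(f y - \int[mu]_z f z) - (g y - \int[mu]_z g z)| <=
    (A y + \int[mu]_z A z) * beta.
Proof.
move=> fi gi Ai fgA y.
have fgi : mu.-integrable setT (EFin \o (fun z => f z - g z)).
  exact: (integrableB measurableT fi gi).
have si : mu.-integrable setT (EFin \o (fun=> s)) by exact: finite_measure_integrable_cst.
have hi : mu.-integrable setT (EFin \o (fun z => (f z - g z) - s)).
  exact: (integrableB measurableT fgi si).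
have Abi : mu.-integrable setT (EFin \o (fun z => A z * beta)).
  exact: (integrableZr measurableT beta Ai).
have int_s : \int[mu]_z s = s by rewrite Rintegral_cst// muT mulr1.
have Ih : `|\int[mu]_z f z - \int[mu]_z g z - s| <= (\int[mu]_z A z) * beta.
  rewrite -{1}int_s -!RintegralB// -RintegralZr//.
  rewrite (le_trans (le_normr_Rintegral _ hi))// le_Rintegral//.
  exact: integrable_norm.
rewrite mulrDl.
have -> : f y - \int[mu]_z f z - (g y - \int[mu]_z g z) =
  (f y - g y - s) - (\int[mu]_z f z - \int[mu]_z g z - s) by ring.
by rewrite (le_trans (ler_normB _ _))// lerD.
Qed.

Lemma powR_lty_integrable (A : YY -> R) (p : R) : 1 <= p ->
  measurable_fun setT A -> (forall y, 0 <= A y) ->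
  (\int[mu]_y (A y `^ p)%:E < +oo)%E -> mu.-integrable setT (EFin \o A).
Proof.
move=> p1 mA A0 Ap.
have mAp : measurable_fun setT (fun y => A y `^ p).
  exact: (measurableT_comp (measurable_powR p)).
have i1 : mu.-integrable setT (EFin \o (fun=> 1 : R)) by exact: finite_measure_integrable_cst.
have iAp : mu.-integrable setT (EFin \o (fun y => A y `^ p)).
  apply/integrableP; split; first exact/measurable_EFinP.
  by under eq_integral => y _ do rewrite /= ger0_norm ?powR_ge0//.
apply: (le_integrable measurableT _ _ (integrableD measurableT i1 iAp)).
  exact/measurable_EFinP.
move=> y _ /=; rewrite lee_fin !ger0_norm ?addr_ge0 ?powR_ge0//.
have [A1|A1] := leP (A y) 1; first by have := powR_ge0 (A y) p; lra.
by have := le1r_powR (ltW A1) p1; lra.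
Qed.

Context {Q : Type} (b : Q -> Q -> R) (c : YY -> Q -> R) (A : YY -> R).
Context {k : nat} (q : 'I_k -> Q) (m : Q).
Hypothesis ci : forall p, mu.-integrable setT (EFin \o (c ^~ p)).
Hypothesis Ai : mu.-integrable setT (EFin \o A).

Let F p := \int[mu]_y c y p.
Let EA := \int[mu]_y A y.
Let dev := deviation b c F A EA q m.

Let centred_integrable (f : YY -> R) (s : R) :
  mu.-integrable setT (EFin \o f) ->
  mu.-integrable setT (EFin \o (fun y => f y - s)).
Proof.
move=> fi.
have si : mu.-integrable setT (EFin \o (fun=> s)) by exact: finite_measure_integrable_cst.
exact: (integrableB measurableT fi si).
Qed.

Let centred_integral (f : YY -> R) : mu.-integrable setT (EFin \o f) ->
  \int[mu]_y (f y - \int[mu]_z f z) = 0.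
Proof.
move=> fi; rewrite RintegralB//; last exact: finite_measure_integrable_cst.
by rewrite Rintegral_cst// muT mulr1 subrr.
Qed.

Let diff_integrable i : mu.-integrable setT
  (EFin \o (fun y => (c y (q i) - F (q i)) - (c y m - F m))).
Proof.
exact: (integrableB measurableT (centred_integrable _ (ci _))
  (centred_integrable _ (ci _))).
Qed.

Lemma integrable_deviation j : mu.-integrable setT (EFin \o dev j).
Proof.
case: j => [i|]; last exact: centred_integrable.
exact: (integrableZr measurableT (b m (q i))^-1 (diff_integrable i)).
Qed.

Lemma integral_deviation j : (\int[mu]_y (dev j y)%:E = 0)%E.
Proof.
rewrite -[LHS]fineK; last exact: integrable_fin_num (integrable_deviation j).
congr EFin; rewrite -[LHS]/(\int[mu]_y dev j y).
case: j => [i|]; last exact: centred_integral.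
rewrite /dev /deviation RintegralZr// RintegralB//; [|exact: centred_integrable..].
by rewrite !centred_integral// subrr mul0r.
Qed.

Lemma deviation_le j y : pseudo_metric b -> (forall y, 0 <= A y) ->
  (forall z p r, `|(c z p - F p) - (c z r - F r)| <= (A z + EA) * b p r) ->
  `|dev j y| <= A y + EA.
Proof.
move=> [b0 _ bC _] A0 lip.
have EA0 : 0 <= EA by rewrite Rintegral_ge0.
case: j => [i|]; last first.
  by rewrite (le_trans (ler_normB _ _))// !ger0_norm.
rewrite /dev /deviation normrM normfV [`|b _ _|]ger0_norm//.
have [->|bq] := eqVneq (b m (q i)) 0.
  by rewrite invr0 mulr0 addr_ge0.
by rewrite ler_pdivrMr ?lt0r ?bq ?b0// bC lip.
Qed.

End deviation_integral.

(** * From deviations to the distance of the minimizers *)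

Section argmin_rate.
Context {R : realType} {Q YY : Type}.

(** The minimality of mn turns F mn - F m into a centred empirical mean, which is
split at q j: the normalized deviation bounds the part between m and q j, and the
Lipschitz property the part between q j and mn, where the empirical mean of A + EA is
at most Phi + 2 * EA thanks to the last coordinate of deviation. *)
Lemma net_deviation (b : Q -> Q -> R) (c : YY -> Q -> R) (F : Q -> R)
    (A : YY -> R) (EA : R) (y : nat -> YY) (n k : nat) (q : 'I_k -> Q)
    (m mn : Q) (j : 'I_k) (Phi : R) :
  pseudo_metric b -> (0 < n)%N ->
  (forall z p r, `|(c z p - F p) - (c z r - F r)| <= (A z + EA) * b p r) ->
  \sum_(l < n) c (y l) mn <= \sum_(l < n) c (y l) m ->
  (forall i, n%:R^-1 * `|\sum_(l < n) deviation b c F A EA q m i (y l)| <= Phi) ->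
  F mn - F m <= b m (q j) * Phi + (Phi + 2 * EA) * b (q j) mn.
Proof.
move=> [b0 bxx bC btri] n0 lip amin SPhi.
have nR : 0 < n%:R :> R by rewrite ltr0n.
have cstE v : n%:R * v = \sum_(l < n) v :> R.
  by rewrite sumr_const card_ord mulr_natl.
have sumS : `|\sum_(l < n) ((c (y l) (q j) - F (q j)) - (c (y l) m - F m))|
    = b m (q j) * `|\sum_(l < n) deviation b c F A EA q m (Some j) (y l)|.
  rewrite -[b m _]ger0_norm// -normrM mulr_sumr; congr (`|_|).
  apply: eq_bigr => i _; rewrite /deviation.
  have [bz|bz] := eqVneq (b m (q j)) 0; last by rewrite mulrC divfK.
  rewrite bz mul0r; apply/eqP; rewrite -normr_le0.
  by rewrite (le_trans (lip _ _ _))// bC bz mulr0.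
have sumA : n%:R^-1 * (\sum_(l < n) (A (y l) + EA)) <= Phi + 2 * EA.
  have -> : \sum_(l < n) (A (y l) + EA) =
      \sum_(l < n) deviation b c F A EA q m None (y l) + n%:R * (2 * EA).
    rewrite cstE -big_split/=.
    by apply: eq_bigr => i _; rewrite /deviation; ring.
  rewrite mulrDr mulKf ?gt_eqF// lerD2r (le_trans _ (SPhi None))//.
  by rewrite ler_pM2l ?invr_gt0// ler_norm.
have -> : F mn - F m = n%:R^-1 * (n%:R * (F mn - F m)) by rewrite mulKf ?gt_eqF.
apply: (@le_trans _ _ (n%:R^-1 *
  (`|\sum_(l < n) ((c (y l) (q j) - F (q j)) - (c (y l) m - F m))|
   + \sum_(l < n) (A (y l) + EA) * b (q j) mn))).
  rewrite ler_pM2l ?invr_gt0//.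
  apply: (@le_trans _ _ (\sum_(l < n) ((c (y l) m - F m) - (c (y l) mn - F mn)))).
    rewrite [leRHS](_ : _ = \sum_(l < n) c (y l) m - \sum_(l < n) c (y l) mn
        + n%:R * (F mn - F m)); first by rewrite lerDr subr_ge0.
    rewrite cstE -sumrB -big_split/=.
    by apply: eq_bigr => i _; ring.
  apply: (@le_trans _ _
      (- (\sum_(l < n) ((c (y l) (q j) - F (q j)) - (c (y l) m - F m)))
      + \sum_(l < n) ((c (y l) (q j) - F (q j)) - (c (y l) mn - F mn)))).
    by rewrite addrC -sumrB ler_sum// => i _; lra.
  rewrite lerD//; first by rewrite -normrN ler_norm.
  by rewrite ler_sum// => i _; rewrite (le_trans (ler_norm _)).
rewrite mulrDr -mulr_suml lerD//.
  by rewrite sumS mulrCA ler_wpM2l.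
by rewrite mulrA ler_wpM2r.
Qed.

(** The bound is linear in B, the growth of order gamma: a factor B cancels.  Below
the threshold, B ^ (gamma - 1) is at most rho, hence at most Phi. *)
Lemma growth_inversion (B Phi rho EA gamma c_g : R) :
  0 <= B -> 1 < gamma -> 0 < c_g -> 0 <= EA -> 0 < rho -> rho <= 1 -> rho <= Phi ->
  (rho `^ (gamma - 1)^-1 < B ->
    c_g * B `^ gamma <= 2 * B * Phi + (Phi + 2 * EA) * (B * rho)) ->
  B `^ (gamma - 1) <= (1 + (3 + 2 * EA) / c_g) * Phi.
Proof.
move=> B0 g1 cg0 EA0 rho0 rho1 rhoPhi grow.
have E3 : 0 <= (3 + 2 * EA) / c_g by rewrite divr_ge0 ?(ltW cg0)//; lra.
have Phi0 : 0 < Phi by exact: lt_le_trans rhoPhi.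
rewrite mulrDl mul1r.
have [Beta|Beta] := leP B (rho `^ (gamma - 1)^-1).
  have EPhi : 0 <= (3 + 2 * EA) / c_g * Phi by rewrite mulr_ge0 ?(ltW Phi0).
  suff : B `^ (gamma - 1) <= rho by lra.
  rewrite (@le_trans _ _ ((rho `^ (gamma - 1)^-1) `^ (gamma - 1)))//.
    by rewrite ge0_ler_powR ?nnegrE ?powR_ge0//; lra.
  by rewrite -powRrM mulVf ?powRr1 ?(ltW rho0)// subr_eq0 gt_eqF.
have B1 : 0 < B by rewrite (le_lt_trans _ Beta)// powR_ge0.
have BE : B `^ gamma = B * B `^ (gamma - 1) by rewrite mulr_powRB1//; lra.
suff : B `^ (gamma - 1) <= (3 + 2 * EA) / c_g * Phi by lra.
rewrite mulrAC ler_pdivlMr// mulrC -(ler_pM2l B1) mulrCA -BE.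
rewrite (le_trans (grow Beta))//.
have e1 : EA * rho <= EA * Phi by rewrite ler_wpM2l.
have e2 : Phi * rho <= Phi by rewrite ler_piMr// ltW.
have -> : 2 * B * Phi + (Phi + 2 * EA) * (B * rho) =
  B * (2 * Phi + Phi * rho + 2 * (EA * rho)) by ring.
by rewrite ler_pM2l//; lra.
Qed.

Lemma le_lse_scale (J : finType) (S : J -> R) n i : (0 < n)%N ->
  n%:R^-1 * `|S i| <=
    lse_scale J n * (lse (fun j => lse_scale J n * S j) / lse_floor J).
Proof.
move=> n0; have J0 : (0 < #|J|)%N by apply/card_gt0P; exists i.
have l1 : 1 <= lse_floor J :> R by exact: lse_floor_ge1.
have l0 : 0 < lse_floor J :> R by exact: lt_le_trans l1.
have nR : 0 < n%:R :> R by rewrite ltr0n.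
have sg0 : 0 < lse_scale J n :> R by rewrite sqrtr_gt0 divr_gt0.
have sg2 : lse_scale J n * lse_scale J n = lse_floor J / n%:R :> R.
  by rewrite -expr2 sqr_sqrtr// divr_ge0// ltW.
have := le_lse J0 (fun j => lse_scale J n * S j) i.
rewrite normrM gtr0_norm// => h.
have -> : n%:R^-1 * `|S i| = lse_scale J n * (lse_scale J n * `|S i| / lse_floor J).
  rewrite !mulrA sg2; have NL := lt0r_neq0 l0; have NN := lt0r_neq0 nR.
  by field; rewrite NL NN.
by rewrite ler_pM2l// ler_pM2r ?invr_gt0.
Qed.

Lemma rsqrt_le_lse_scale (J : finType) n : (0 < #|J|)%N ->
  n%:R `^ (- 2^-1) <= lse_scale J n :> R.
Proof.
move=> J0; rewrite powRN powR12_sqrt// -sqrtrV// ler_wsqrtr//.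
by rewrite ler_peMl ?invr_ge0// lse_floor_ge1.
Qed.

(** The radius of the net is the product of the threshold of growth_inversion and of
n^(- 1/2): beyond the threshold it is small compared with b m mn, so that the
normalization at q j is comparable with b m mn. *)
Lemma argmin_rate (b : Q -> Q -> R) (c : YY -> Q -> R) (F : Q -> R)
    (A : YY -> R) (EA : R) (y : nat -> YY) (n k : nat) (q : 'I_k -> Q)
    (m mn : Q) (gamma c_g : R) :
  pseudo_metric b -> (0 < n)%N -> 1 < gamma -> 0 < c_g -> 0 <= EA ->
  (forall z p r, `|(c z p - F p) - (c z r - F r)| <= (A z + EA) * b p r) ->
  c_g * b m mn `^ gamma <= F mn - F m ->
  \sum_(l < n) c (y l) mn <= \sum_(l < n) c (y l) m ->
  (exists j, b (q j) mn <=
     (n%:R `^ (- 2^-1)) `^ (gamma - 1)^-1 * n%:R `^ (- 2^-1)) ->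
  b m mn `^ (gamma - 1) <=
    (1 + (3 + 2 * EA) / c_g) *
    (lse_scale (option 'I_k) n * (lse (fun j => lse_scale (option 'I_k) n *
       \sum_(l < n) deviation b c F A EA q m j (y l)) / lse_floor (option 'I_k))).
Proof.
move=> bpm n0 g1 cg0 EA0 lip grow amin [j qj]; set J := option 'I_k.
have [b0 bxx bC btri] := bpm.
have J0 : (0 < #|{: J}|)%N by rewrite card_option.
have l0 : 0 < lse_floor J :> R by exact: lt_le_trans (lse_floor_ge1 J0).
set rho : R := n%:R `^ (- 2^-1) in qj *.
have rho0 : 0 < rho by rewrite powR_gt0// ltr0n.
have rho1 : rho <= 1.
  rewrite /rho powRN invf_le1 ?powR_gt0 ?ltr0n// powR12_sqrt//.
  by rewrite -[leLHS]sqrtr1 ler_wsqrtr// ler1n.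
have rho_sg : rho <= lse_scale J n by exact: rsqrt_le_lse_scale.
have SPhi i :=
  le_lse_scale (fun i => \sum_(l < n) deviation b c F A EA q m i (y l)) i n0.
set Phi := lse_scale J n * _ in SPhi *.
have rhoPhi : rho <= Phi.
  rewrite (le_trans rho_sg)// ler_peMr ?sqrtr_ge0// ler_pdivlMr// mul1r.
  exact: lse_ge_floor.
apply: (@growth_inversion _ _ rho) => // Beta.
have rB : b (q j) mn <= b m mn * rho by rewrite (le_trans qj)// ler_pM2r// ltW.
have bq : b m (q j) <= 2 * b m mn.
  rewrite (le_trans (btri m mn (q j)))// mulr_natl mulr2n lerD2l bC (le_trans rB)//.
  by rewrite ler_piMr.
have Phi0 : 0 <= Phi by rewrite ltW// (lt_le_trans rho0).
rewrite (le_trans grow)// (le_trans (net_deviation j bpm n0 lip amin SPhi))//.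
by rewrite lerD// ?ler_wpM2r ?ler_wpM2l// addr_ge0// mulr_ge0.
Qed.

End argmin_rate.

(** * Covering numbers and the size of the potential *)

Section covering.
Context {R : realType} {Q : Type}.

(** The factor 2 leaves room for the infimum not to be attained. *)
Lemma covering_number_net (E : set Q) (b : Q -> Q -> R) (r x : R) : 0 <= x ->
  (sqrte (lne (covering_number E b r)) <= x%:E)%E ->
  exists k, Defs.covered_by E b r k /\ k%:R <= 2 * expR (x ^+ 2).
Proof.
move=> x0 Nx.
have : (covering_number E b r < (2 * expR (x ^+ 2))%:E)%E.
  apply: (@le_lt_trans _ _ (expR (x ^+ 2))%:E); last first.
    by rewrite lte_fin ltr_pMl ?expR_gt0// ltr1n.
  case: (covering_number E b r) Nx => [t| |] //=; last by rewrite leNye.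
  case: ifPn => [t0 _|t0].
    by rewrite lee_fin (le_trans t0)// expR_ge0.
  rewrite -ltNge in t0.
  rewrite !lee_fin => tx; rewrite -[leLHS](@lnK R) ?posrE// ler_expR.
  have [lt0|lt0] := leP (ln t) 0; first by rewrite (le_trans lt0)// sqr_ge0.
  by rewrite -(sqr_sqrtr (ltW lt0)) lerXn2r ?nnegrE ?sqrtr_ge0.
move=> /ereal_inf_lt[_ [k Ek <-]]; rewrite lte_fin => /ltW kx.
by exists k.
Qed.

End covering.

Section scale_rate.
Context {R : realType}.

(** For k at most 2 * exp (x ^+ 2), lse_floor = 1 + ln (2 * (k + 1)) is at most
1 + ln 6 + x ^+ 2, whence the constant 7. *)
Lemma lse_scale_le (k n : nat) (s L : R) : (0 < n)%N -> 1 <= L ->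
  k%:R <= 2 * expR ((s * L) ^+ 2) ->
  lse_scale (option 'I_k) n <= Num.sqrt (7 + s ^+ 2) * (n%:R `^ (- 2^-1) * L).
Proof.
move=> n0 L1 kL.
have s2 := sqr_ge0 s; have L2 : 1 <= L ^+ 2 by nra.
set E := expR _ in kL.
have E1 : 1 <= E by rewrite -expR0 ler_expR sqr_ge0.
have lE : lse_floor (option 'I_k) <= (7 + s ^+ 2) * L ^+ 2.
  apply: (@le_trans _ _ (1 + (6 + (s * L) ^+ 2))); last by rewrite exprMn; nra.
  rewrite /lse_floor card_option card_ord lerD2l.
  rewrite (@le_trans _ _ (ln (6 * E)))//.
    rewrite ler_ln ?posrE -?natr1 ?mulr_gt0 ?addr_ge0//; lra.
  rewrite lnM ?posrE//; last by lra.
  by rewrite /E expRK lerD2r ltW// ln_sublinear.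
have L0 : 0 <= L by lra.
rewrite /lse_scale sqrtrM; last by rewrite (le_trans ler01)// lse_floor_ge1// card_option.
rewrite powRN powR12_sqrt// -sqrtrV// mulrCA mulrC ler_wpM2l ?sqrtr_ge0//.
rewrite (le_trans (ler_wsqrtr lE))// sqrtrM ?addr_ge0//.
by rewrite sqrtr_sqr ger0_norm.
Qed.

End scale_rate.

(** * The rate of convergence *)

Section pseudo_metric_measurability.
Context d (T : measurableType d) (R : realType) (Q : Type) (b : Q -> Q -> R).

Lemma measurable_pm_dist (m : Q) (f : T -> Q) : pseudo_metric b ->
  pm_measurable_fun b f -> measurable_fun setT (fun w => b m (f w)).
Proof.
move=> [_ _ bC btri] mf.
apply: (measurability _ (RGenInftyO.measurableE R)) => //.
move=> /= _ [_ [x ->] <-]; rewrite setTI preimage_itvNyo.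
apply: (mf [set q | b m q < x]); apply: sub_sigma_algebra => q /= qx.
exists ((x - b m q) / 2); first by rewrite divr_gt0// subr_gt0.
move=> r; rewrite /cball/= => qr; have := btri m q r; lra.
Qed.

End pseudo_metric_measurability.

Section rate.
Context {R : realType}.

(** The pointwise bound of argmin_rate is raised to the power zeta.  Since
lse / lse_floor >= 1, its power zeta is at most its power p, whose mean
integral_lse_walk bounds. *)
Lemma moment_rate (Q : Type) (dY : measure_display) (YY : measurableType dY)
    (d : measure_display) (Omega : measurableType d) (P : probability Omega R)
    (Y : {RV P >-> YY}) (Ys : nat -> {RV P >-> YY}) (c : YY -> Q -> R)
    (A : YY -> R) (b : Q -> Q -> R) (m : Q) (mn : Omega -> Q)
    (gamma c_g kappa p K : R) (n k : nat) (q : 'I_k -> Q)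
    (mu := distribution P Y) (EA := \int[mu]_y A y)
    (F := fun r => \int[mu]_y c y r) (zeta := kappa / (gamma - 1)) :
  (forall i, same_law (Ys i) Y) -> independent_seq Ys -> pseudo_metric b ->
  1 < gamma -> 0 < c_g -> 0 < zeta -> zeta <= p -> 2 <= p -> (0 < n)%N ->
  measurable_fun setT A -> (forall y, 0 <= A y) ->
  mu.-integrable setT (EFin \o A) ->
  (\int[mu]_y (1 + (A y + EA) `^ p)%:E <= K%:E)%E ->
  (forall r, mu.-integrable setT (EFin \o (c ^~ r))) ->
  (forall z r s, `|(c z r - F r) - (c z s - F s)| <= (A z + EA) * b r s) ->
  pm_measurable_fun b mn ->
  (forall w, c_g * b m (mn w) `^ gamma <= F (mn w) - F m) ->
  (forall w, \sum_(l < n) c (Ys l w) (mn w) <= \sum_(l < n) c (Ys l w) m) ->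
  (forall w, exists j, b (q j) (mn w) <=
     (n%:R `^ (- 2^-1)) `^ (gamma - 1)^-1 * n%:R `^ (- 2^-1)) ->
  (\int[P]_w (b m (mn w) `^ kappa)%:E <=
    (((1 + (3 + 2 * EA) / c_g) * lse_scale (option 'I_k) n) `^ zeta *
     expR (lse_step_cst p * K))%:E)%E.
Proof.
move=> law indep bpm g1 cg0 z0 zp p2 n0 mA A0 Ai AK ci lip mmn grow amin near.
have [b0 _ _ _] := bpm.
set J := option 'I_k; set C3 := 1 + _ / _.
have J0 : (0 < #|{: J}|)%N by rewrite card_option.
have EA0 : 0 <= EA by rewrite Rintegral_ge0.
have C30 : 0 <= C3 by rewrite addr_ge0// divr_ge0 ?addr_ge0 ?mulr_ge0// ltW.
have l0 : 0 < lse_floor J :> R by exact: lt_le_trans (lse_floor_ge1 J0).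
pose dev := deviation b c F A EA q m.
pose psi w := lse (fun j => lse_scale J n * \sum_(l < n) dev j (Ys l w)).
have psil w : 1 <= psi w / lse_floor J.
  by rewrite ler_pdivlMr// mul1r; exact: lse_ge_floor.
have kE : kappa = (gamma - 1) * zeta by rewrite mulrC divfK// subr_eq0 gt_eqF.
pose M := (C3 * lse_scale J n) `^ zeta * (lse_floor J `^ p)^-1.
have M0 : 0 <= M by rewrite mulr_ge0 ?invr_ge0 ?powR_ge0.
have pt w : b m (mn w) `^ kappa <= M * psi w `^ p.
  have := @argmin_rate _ _ _ _ _ _ _ _ (fun l => Ys l w) _ _ _ _ _ _ _
    bpm n0 g1 cg0 EA0 lip (grow w) (amin w) (near w).
  rewrite -/dev -/(psi w) -/C3 => rate.
  have pl0 : 0 <= psi w / lse_floor J by exact: le_trans ler01 (psil w).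
  rewrite kE powRrM.
  apply: (@le_trans _ _ ((C3 * (lse_scale J n * (psi w / lse_floor J))) `^ zeta)).
    rewrite ge0_ler_powR ?nnegrE ?powR_ge0 ?(ltW z0)//.
    by rewrite mulr_ge0// mulr_ge0// lse_scale_ge0.
  rewrite [C3 * _]mulrA powRM//; last by rewrite mulr_ge0// lse_scale_ge0.
  rewrite /M -mulrA ler_wpM2l ?powR_ge0//.
  rewrite (le_trans (ler_powR (psil w) zp))// powRM ?invr_ge0 ?(ltW l0)//; last first.
    by rewrite (le_trans _ (lse_ge_floor J0 _))// ltW.
  by rewrite -powR_inv1 ?(ltW l0)// -powRrM mulN1r powRN mulrC.
have mdev j : measurable_fun setT (dev j).
  exact/measurable_EFinP/(measurable_int mu)/integrable_deviation.
have mpsi : measurable_fun setT (fun w => psi w `^ p).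
  apply: (measurableT_comp (measurable_powR p)); apply: measurable_lse => j.
  apply: measurable_funM => //; apply: measurable_sum => l.
  exact: (measurableT_comp (mdev j)).
apply: (@le_trans _ _ (\int[P]_w (M%:E * (psi w `^ p)%:E))%E).
  apply: ge0_le_integral.
  - exact: measurableT.
  - by move=> w _; rewrite lee_fin powR_ge0.
  - apply/measurable_EFinP; apply: (measurableT_comp (measurable_powR kappa)).
    exact: measurable_pm_dist.
  - by apply: measurable_funeM; exact/measurable_EFinP.
  - by move=> w _; rewrite -EFinM lee_fin.
rewrite ge0_integralZl//=; last 2 first.
- exact/measurable_EFinP.
- by move=> w _; rewrite lee_fin powR_ge0.
have mD : measurable_fun setT (fun y => A y + EA) by exact: measurable_funD.
have D0 y : 0 <= A y + EA by rewrite addr_ge0.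
have dev_le j y : `|dev j y| <= A y + EA by exact: deviation_le.
have := integral_lse_walk indep law J0 p2 n0 mD D0 AK
  (integrable_deviation b q m ci Ai) (integral_deviation b q m ci Ai) dev_le.
move=> /(@lee_wpmul2l _ M%:E); rewrite lee_fin => /(_ M0) /le_trans; apply.
rewrite -EFinM lee_fin /M -mulrA ler_wpM2l ?powR_ge0//.
by rewrite mulrCA mulVf ?mulr1// gt_eqF// powR_gt0.
Qed.

End rate.

Theorem theorem4 (R : realType) (Q : Type)
    (dY : measure_display) (YY : measurableType dY)
    (d : measure_display) (Omega : measurableType d) (P : probability Omega R)
    (Y Y' : {RV P >-> YY}) (Ys : nat -> {RV P >-> YY})
    (c : YY -> Q -> R)
    (a : YY -> YY -> R) (b : Q -> Q -> R)
    (o m : Q) (m_ : nat -> Omega -> Q)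
    (gamma c_g kappa beta c_e : R)
    (c_measurable : forall q, measurable_fun setT (fun y => c y q))
    (Ys_law : forall i, same_law (Ys i) Y)
    (Ys_indep : independent_seq Ys)
    (Y'_law : same_law Y' Y)
    (Y'_indep : independent_pair Y' Y)
    (a_ge0 : forall y z, 0 <= a y z)
    (a_measurable : measurable_fun setT (fun yz : YY * YY => a yz.1 yz.2))
    (b_pseudo_metric : pseudo_metric b)
    (weak_quadruple : forall p q y z,
       c y q - c z q - c y p + c z p <= a y z * b q p)
    (c_integrable : forall q, ('E_P[(fun w => `|c (Y w) q|%R)] < +oo)%E)
    (m_measurable : forall n, (0 < n)%N -> pm_measurable_fun b (m_ n))
    (m_argmin : forall n, (0 < n)%N -> forall w,
       argmin (cball o b n%:R) (empirical_objective c Ys n w) (m_ n w))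
    (m_min : argmin setT (objective c Y) m)
    (gamma_gt1 : 1 < gamma) (c_g_gt0 : 0 < c_g)
    (growth : forall q,
       objective c Y q - objective c Y m >= c_g * b m q `^ gamma)
    (kappa_gt : kappa > gamma - 1)
    (strong_moment : (moment a Y' Y (kappa / (gamma - 1)) < +oo)%E)
    (beta_gt0 : 0 < beta) (c_e_gt0 : 0 < c_e)
    (small_entropy : exists2 delta0 : R, 0 < delta0 &
       forall delta, delta0 <= delta -> forall r, 0 < r -> r <= delta ->
       (sqrte (lne (covering_number (cball o b delta) b r))
         <= (c_e * ln (delta / r) `^ beta)%:E)%E) :
  exists C : R, \forall n \near \oo,
    ('E_P[(fun w => (b m (m_ n w) `^ kappa)%R)]
      <= (C * (n%:R `^ (- 2^-1) * ln n%:R `^ beta)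
                `^ (kappa / (gamma - 1)))%:E)%E.
Proof.
set mu := distribution P Y; set zeta := kappa / (gamma - 1).
have g0 : 0 < gamma - 1 by rewrite subr_gt0.
have zeta_gt1 : 1 < zeta by rewrite ltr_pdivlMr// mul1r.
have zeta_gt0 : 0 < zeta by rewrite (lt_trans ltr01).
pose p := Num.max 2 zeta.
have p2 : 2 <= p by rewrite le_max lexx.
have zp : zeta <= p by rewrite le_max lexx orbT.
have p0 : 0 <= p by rewrite (le_trans _ p2).
have p1 : 1 <= p by rewrite (le_trans _ p2)// ler1n.
have [z0 az0] := exists_reference_point Y'_law Y'_indep a_measurable
  (moment_lty a_ge0 zeta_gt0 strong_moment).
pose A y := a y z0.
have mA : measurable_fun setT A by exact: (measurable_fun_pair1 z0 a_measurable).
have A0 y : 0 <= A y by exact: a_ge0.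
have Ai : mu.-integrable setT (EFin \o A).
  exact: powR_lty_integrable p1 mA A0 az0.
pose EA := \int[mu]_y A y.
have EA0 : 0 <= EA by rewrite Rintegral_ge0.
have mc r : measurable_fun setT (EFin \o (c ^~ r)) by exact/measurable_EFinP.
have ciP r : P.-integrable setT ((EFin \o (c ^~ r)) \o Y).
  apply/integrableP; split; first exact: measurableT_comp (mc r) _.
  by have := c_integrable r; rewrite unlock.
have ci r : mu.-integrable setT (EFin \o (c ^~ r)).
  by apply: integrable_pushforward.
pose F r := \int[mu]_y c y r.
have FE r : objective c Y r = F r.
  by rewrite /objective unlock /F /Rintegral (integral_distribution (mc r) (ciP r)).
have [b0 bxx bC btri] := b_pseudo_metric.
have lip z r1 r2 : `|(c z r1 - F r1) - (c z r2 - F r2)| <= (A z + EA) * b r1 r2.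
  apply: (@centred_lipschitz _ _ _ mu (c ^~ r1) (c ^~ r2) A
    (c z0 r1 - c z0 r2)) => // y.
  (* exchanging the two descriptors bounds the quadruple difference from below *)
  have h1 := weak_quadruple r2 r1 y z0; have h2 := weak_quadruple r1 r2 y z0.
  rewrite bC in h2; rewrite /A ler_norml; apply/andP; split; lra.
have [K AK] : exists K : R, (\int[mu]_y (1 + (A y + EA) `^ p)%:E <= K%:E)%E.
  exists (fine (\int[mu]_y (1 + (A y + EA) `^ p)%:E)%E).
  rewrite fineK// ge0_fin_numE; first exact: integral_shift_powR_lty.
  by apply: integral_ge0 => y _; rewrite lee_fin addr_ge0 ?powR_ge0.
have [delta0 delta0_gt0 entropy] := small_entropy.
(* n divided by the radius of the net is n ^ theta *)
pose theta := 1 + (2^-1 * (gamma - 1)^-1 + 2^-1).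
have theta0 : 0 <= theta by rewrite !addr_ge0 ?mulr_ge0 ?invr_ge0 ?(ltW g0).
pose s := c_e * theta `^ beta.
have s0 : 0 <= s by rewrite mulr_ge0 ?powR_ge0 ?ltW.
pose C3 := 1 + (3 + 2 * EA) / c_g.
have C30 : 0 <= C3 by rewrite addr_ge0// divr_ge0 ?addr_ge0 ?mulr_ge0// ltW.
exists ((C3 * Num.sqrt (7 + s ^+ 2)) `^ zeta * expR (lse_step_cst p * K)).
near=> n.
have n_delta0 : delta0 <= n%:R by near: n; exact: nbhs_infty_ger.
have n_e : expR 1 <= n%:R :> R by near: n; exact: nbhs_infty_ger.
have n_m : b o m <= n%:R by near: n; exact: nbhs_infty_ger.
have nR : 0 < n%:R :> R by rewrite (lt_le_trans _ n_e)// expR_gt0.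
have n0 : (0 < n)%N by rewrite -(ltr0n R).
have n1 : 1 <= n%:R :> R by rewrite ler1n.
have ln1 : 1 <= ln (n%:R : R) by rewrite -[leLHS]expRK ler_ln ?posrE ?expR_gt0.
set L := ln n%:R `^ beta.
have L1 : 1 <= L by rewrite -[leLHS](powRr0 (ln n%:R)) ler_powR// ltW.
pose rad : R := (n%:R `^ (- 2^-1)) `^ (gamma - 1)^-1 * n%:R `^ (- 2^-1).
have rE : rad = n%:R `^ (1 - theta).
  rewrite /rad -powRrM -powRD; last by rewrite (gt_eqF nR) implybT.
  by congr (_ `^ _); rewrite /theta; ring.
have rad0 : 0 < rad by rewrite rE powR_gt0.
have rad_n : rad <= n%:R.
  rewrite rE -[leRHS]powRr1// ler_powR// /theta.
  by rewrite gerBl !addr_ge0 ?mulr_ge0 ?invr_ge0 ?(ltW g0).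
have ln_nr : ln (n%:R / rad) = theta * ln n%:R.
  by rewrite ln_div ?posrE// rE ln_powR; ring.
have sL0 : 0 <= s * L by rewrite mulr_ge0// (le_trans ler01).
have entE : c_e * ln (n%:R / rad) `^ beta = s * L.
  by rewrite ln_nr powRM ?mulrA// (le_trans ler01).
have := entropy _ n_delta0 _ rad0 rad_n; rewrite entE => /(covering_number_net sL0).
move=> [k [[q cover] kL]].
have mQ w : cball o b n%:R (m_ n w) by have [] := m_argmin n n0 w.
have near_q w : exists j, b (q j) (m_ n w) <= rad.
  by have [j _ ?] := cover _ (mQ w); exists j.
have amin w : \sum_(l < n) c (Ys l w) (m_ n w) <= \sum_(l < n) c (Ys l w) m.
  have [_ /(_ m n_m)] := m_argmin n n0 w.
  by rewrite /empirical_objective ler_pM2l ?invr_gt0.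
have grow w : c_g * b m (m_ n w) `^ gamma <= F (m_ n w) - F m.
  by rewrite -!FE; exact: growth.
rewrite expectation.unlock.
apply: (le_trans (moment_rate Ys_law Ys_indep b_pseudo_metric gamma_gt1 c_g_gt0
  zeta_gt0 zp p2 n0 mA A0 Ai AK ci lip (m_measurable n n0) grow amin near_q)).
rewrite lee_fin -/zeta -/C3 mulrAC ler_pM2r ?expR_gt0//.
rewrite -powRM ?mulr_ge0 ?sqrtr_ge0 ?powR_ge0//.
rewrite ge0_ler_powR ?nnegrE ?(ltW zeta_gt0) ?mulr_ge0 ?lse_scale_ge0 ?sqrtr_ge0//
  ?powR_ge0//.
by rewrite -mulrA ler_wpM2l// lse_scale_le.
Unshelve. all: by end_near.
Qed.
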